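(* Let $p,q,r$ be positive real numbers with $0<r<\frac1q$ and $p>\max\{1,\frac1q\}$. Let $\lambda>0$ and let $(u,v)$ be a classical solution of $$-u''=\lambda|v|^{r-1}v+|v|^{p-1}v,\qquad -v''=|u|^{q-1}u\qquad\text{in }(0,1),$$ $$u(0)=u(1)=0,\qquad v(0)=v(1)=0,$$ with $u,v>0$ in $(0,1)$. Then: (i) $u$ and $v$ are symmetric with respect to the vertical line $x=\frac12$, i.e. $u(1-x)=u(x)$ and $v(1-x)=v(x)$ for all $x\in[0,1]$; (ii) $u(\frac12)=\|u\|_{L^\infty(0,1)}$ and $v(\frac12)=\|v\|_{L^\infty(0,1)}$; (iii) $x=\frac12$ is the only critical point of $u$ and the only critical point of $v$.
   Context: A classical solution is a pair $(u,v)$ with $u,v\in C^2(0,1)\cap C[0,1]$ such that the equations and boundary conditions hold pointwise. *)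

(* Defs.v *)
From HB Require Import structures.
From mathcomp Require Import all_boot all_order all_algebra.
From mathcomp Require Import all_classical all_reals all_analysis.

Set Implicit Arguments.
Unset Strict Implicit.
Unset Printing Implicit Defensive.

Import Order.TTheory GRing.Theory Num.Theory.
Import numFieldNormedType.Exports.

Local Open Scope classical_set_scope.
Local Open Scope ring_scope.

(* Functions on [0, 1] are represented by total functions R -> R whose values
   outside [0, 1] play no role. *)

(* |t|^(s - 1) t; this is 0 at t = 0, also when s <= 1, because `^ is total
   with finite values at 0. *)
Definition signed_pow (R : realType) (s t : R) : R := `|t| `^ (s - 1) * t.

Definition C2_on_oo (R : realType) (a b : R) (f : R -> R) : Prop :=
  [/\ {in `]a, b[, forall x, derivable f x 1},
      {in `]a, b[, forall x, derivable f^`()%classic x 1} &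
      {in `]a, b[, continuous f^`(2)%classic}].

Definition classical_regularity (R : realType) (f : R -> R) : Prop :=
  C2_on_oo 0 1 f /\ {within `[0, 1], continuous f}.

Definition classical_solution (R : realType) (lambda p q r : R)
    (u v : R -> R) : Prop :=
  [/\ classical_regularity u /\ classical_regularity v,
      {in `]0, 1[, forall x,
        - u^`(2)%classic x = lambda * signed_pow r (v x) + signed_pow p (v x)},
      {in `]0, 1[, forall x, - v^`(2)%classic x = signed_pow q (u x)},
      u 0 = 0 /\ u 1 = 0 &
      v 0 = 0 /\ v 1 = 0].

Definition lebesgue01 (R : realType) : set (measurableTypeR R) -> \bar R :=
  mrestr (@lebesgue_measure R) (measurable_itv `]0, 1[).

HB.instance Definition _ (R : realType) := Measure.on (@lebesgue01 R).

Definition Linfty_norm01 (R : realType) (f : R -> R) : \bar R :=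
  Lnorm (@lebesgue01 R) +oo%E (EFin \o f).

Definition critical_point01 (R : realType) (f : R -> R) (x : R) : Prop :=
  (x \in `]0, 1[) /\ is_derive x 1 f 0.

(* Main.v *)
Require Import Defs.
From HB Require Import structures.
From mathcomp Require Import all_boot all_order all_algebra.
From mathcomp Require Import all_classical all_reals all_analysis.
From mathcomp Require Import ess_sup_inf lra.

Import Order.TTheory GRing.Theory Num.Theory.
Import numFieldNormedType.Exports.

Local Open Scope classical_set_scope.
Local Open Scope ring_scope.

(** The proof is the method of moving planes on an interval.  Both right-hand
sides are positive, so u and v are strictly concave and positive inside, and
the system is cooperative: the source of u is a nondecreasing function of v and
conversely.  Compare u with its reflection in a point s < 1/2: if the
reflections of both functions dominate the functions on [0, s], then
cooperativity makes the differences u(2s - x) - u(x) and v(2s - x) - v(x)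
concave there.  They vanish at s and are positive at 0 because 2s < 1, so they
are positive on [0, s) and decrease strictly at s, that is u'(s) > 0 and
v'(s) > 0 ([reflected_gap]).  Only the positivity and the
monotonicity of the nonlinearities enter, so it does no harm that t^r and t^q
need not be Lipschitz at 0.

Usually s is then pushed continuously up to 1/2.  Here a single minimization
replaces the continuation ([moving_plane]).  Let c be the smallest of 1/2 and
the peaks of u and v, and among all pairs x <= c <= y in
[0, 1] at which u or v fails to increase strictly from x
to y, take one with the smallest midpoint s; such a
pair exists by compactness, and (c, c) is one, so s <= c.  By minimality the
reflections in s dominate both functions on [0, s].  If s < 1/2, the strict
inequalities above leave only x = y = s = c; but then c is the peak of u or of
v, where one of the derivatives is zero instead of positive.  Hence s = c = 1/2:
both peaks lie at or after 1/2, and u(x) <= u(1 - x), v(x) <= v(1 - x) for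
x <= 1/2.

Applying this also to the pair reversed by x -> 1 - x gives equality and puts
both peaks at 1/2 ([bumps_symmetric]).  By strict concavity the peak is the only
critical point, and the supremum norm of a function that is continuous at its
peak is its peak value ([Linfty_norm01_max]). *)

Set Implicit Arguments.
Unset Strict Implicit.
Unset Printing Implicit Defensive.

(** * Concave bumps *)

(** The right-hand side of - u'' = h is kept as a function h of the position: a
coupling between two bumps then only has to say how their sources are ordered,
and reversing the interval preserves the structure.  Continuity on the whole
line, rather than on [0, 1], spares all later arguments the two endpoints; a
solution is put in this form by extending it by constants. *)
Record concave_bump (R : realType) (u du h : R -> R) : Prop := ConcaveBump {
  bump_continuous : continuous u;
  bump_at0 : u 0 = 0;
  bump_at1 : u 1 = 0;
  bump_gt0 : forall x : R, 0 < x < 1 -> 0 < u x;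
  bump_derive : forall x : R, 0 < x < 1 -> is_derive x 1 u (du x);
  bump_derive2 : forall x : R, 0 < x < 1 -> is_derive x 1 du (- h x);
  bump_source_gt0 : forall x : R, 0 < x < 1 -> 0 < h x }.

Lemma is_derive_reflect (R : realType) (a : R) (f : R -> R) (x d : R) :
  is_derive (a - x) 1 f d -> is_derive x 1 (fun t => f (a - t)) (- d).
Proof.
move=> fd.
have ad : is_derive x 1 (fun t : R => a - t) (-1).
  have := is_deriveB (is_derive_cst a x 1) (is_derive_id x 1).
  by rewrite sub0r.
have := @is_derive1_comp _ f (fun t => a - t) x d (-1) fd ad.
by rewrite mulrN1.
Qed.

Lemma concave_bump_rev (R : realType) (u du h : R -> R) :
  concave_bump u du h ->
  concave_bump (fun x => u (1 - x)) (fun x => - du (1 - x))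
    (fun x => h (1 - x)).
Proof.
move=> [uc u0 u1 up ud udd hp].
have rev01 (x : R) : 0 < x < 1 -> 0 < 1 - x < 1 by lra.
split=> [x||||x /rev01 x01|x /rev01 x01|x /rev01 x01].
- apply: (@continuous_comp _ _ _ (fun t : R => 1 - t) u); last exact: uc.
  by apply: cvgB; [exact: cvg_cst|exact: cvg_id].
- by rewrite subr0.
- by rewrite subrr.
- by move=> x /rev01 /up.
- exact: is_derive_reflect (ud _ x01).
- apply: is_derive_eq; first exact: is_deriveN (is_derive_reflect (udd _ x01)).
  by rewrite !opprK.
- exact: hp.
Qed.

Lemma bump_derive_decr (R : realType) (u du h : R -> R) (x y : R) :
  concave_bump u du h -> 0 < x -> x < y -> y < 1 -> du y < du x.
Proof.
move=> [_ _ _ _ _ udd hp] x0 xy y1.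
have dud z : z \in `]x, y[ -> is_derive z 1 du (- h z).
  by rewrite in_itv/= => ?; apply: udd; lra.
have duc : {within `[x, y], continuous du}.
  apply: derivable_within_continuous => z; rewrite in_itv/= => ?.
  by apply: ex_derive; apply: udd; lra.
have [z + zE] := MVT xy dud duc.
rewrite in_itv/= => zxy.
have z01 : 0 < z < 1 by lra.
have := hp _ z01.
nra.
Qed.

Lemma bump_critical_uniq (R : realType) (u du h : R -> R) (x y : R) :
  concave_bump u du h -> 0 < x < 1 -> 0 < y < 1 ->
  du x = 0 -> du y = 0 -> x = y.
Proof.
move=> ub x01 y01 dx dy; case: (ltgtP x y) => // xy.
- have : du y < du x by apply: (bump_derive_decr ub); lra.
  by rewrite dx dy ltxx.
- have : du x < du y by apply: (bump_derive_decr ub); lra.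
  by rewrite dx dy ltxx.
Qed.

Lemma bump_critical (R : realType) (u du h : R -> R) :
  concave_bump u du h -> exists2 c : R, 0 < c < 1 & du c = 0.
Proof.
move=> [uc u0 u1 _ ud _ _].
have u01 : u 0 = u 1 by rewrite u0 u1.
have [x|c + c0] := Rolle ltr01 _ (continuous_subspaceT uc) u01.
  by rewrite in_itv/= => x01; apply: ex_derive; exact: ud.
rewrite in_itv/= => c01; exists c => //.
by rewrite -(@derive_val _ _ _ _ _ _ _ (ud _ c01)) (@derive_val _ _ _ _ _ _ _ c0).
Qed.

Lemma bump_nondecr (R : realType) (u du h : R -> R) (c x y : R) :
  concave_bump u du h -> 0 < c < 1 -> du c = 0 ->
  0 <= x -> x <= y -> y <= c -> u x <= u y.
Proof.
move=> ub c01 dc x0; rewrite le_eqVlt => /predU1P[->//|xy yc].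
have ud z : z \in `]x, y[ -> is_derive z 1 u (du z).
  by rewrite in_itv/= => ?; apply: (bump_derive ub); lra.
have [z + zE] := MVT xy ud (continuous_subspaceT (bump_continuous ub)).
rewrite in_itv/= => zxy.
have : 0 < du z by rewrite -dc; apply: (bump_derive_decr ub); lra.
nra.
Qed.

(** The difference W(x) = u(2s - x) - u(x) has second derivative
h(x) - h(2s - x) <= 0 on (0, s), with W(0) = u(2s) > 0 and W(s) = 0.  So W lies
on or above a chord that decreases strictly from 0 to s, which forces W > 0
before s and W'(s) = - 2 u'(s) < 0. *)
Lemma reflected_gap (R : realType) (u du h : R -> R) (s : R) :
  concave_bump u du h -> 0 < s -> s < 1 / 2 ->
  (forall x : R, 0 < x < s -> h x <= h (2 * s - x)) ->
  (forall x : R, 0 <= x < s -> u x < u (2 * s - x)) /\ 0 < du s.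
Proof.
move=> [uc u0 u1 up ud udd hp] s0 s12 hle.
pose W x := u (2 * s - x) - u x.
pose dW x := - du (2 * s - x) - du x.
have WD x : 0 < x <= s -> is_derive x 1 W (dW x).
  move=> xs; apply: is_deriveB; last by apply: ud; lra.
  by apply: is_derive_reflect; apply: ud; lra.
have dWD x : 0 < x <= s -> is_derive x 1 dW (h x - h (2 * s - x)).
  move=> xs; have x01 : 0 < x < 1 by lra.
  have y01 : 0 < 2 * s - x < 1 by lra.
  apply: is_derive_eq.
    apply: is_deriveB (udd _ x01).
    exact: is_deriveN (is_derive_reflect (udd _ y01)).
  by rewrite !opprK addrC.
have WC : continuous W.
  move=> x; apply: cvgB; last exact: uc.
  apply: (@continuous_comp _ _ _ (fun t : R => 2 * s - t) u); last exact: uc.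
  by apply: cvgB; [exact: cvg_cst|exact: cvg_id].
have dW_nincr x y : 0 < x -> x < y -> y <= s -> dW y <= dW x.
  move=> x0 xy ys.
  have D z : z \in `]x, y[ -> is_derive z 1 dW (h z - h (2 * s - z)).
    by rewrite in_itv/= => ?; apply: dWD; lra.
  have C : {within `[x, y], continuous dW}.
    apply: derivable_within_continuous => z; rewrite in_itv/= => ?.
    by apply: ex_derive; apply: dWD; lra.
  have [z + zE] := MVT xy D C.
  rewrite in_itv/= => zxy.
  have zs : 0 < z < s by lra.
  have := hle _ zs.
  nra.
have WMVT x y : 0 <= x -> x < y -> y <= s ->
    exists2 z, x < z < y & W y - W x = dW z * (y - x).
  move=> x0 xy ys.
  have D z : z \in `]x, y[ -> is_derive z 1 W (dW z).
    by rewrite in_itv/= => ?; apply: WD; lra.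
  have [z + zE] := MVT xy D (continuous_subspaceT WC).
  by rewrite in_itv/=; exists z.
have W0 : 0 < W 0 by rewrite /W subr0 u0 subr0; apply: up; lra.
have Ws : W s = 0.
  by rewrite /W (_ : 2 * s - s = s) ?subrr//; lra.
split=> [x /andP[]|].
  rewrite le_eqVlt => /predU1P[<- _|x0 xs]; first by rewrite -subr_gt0.
  rewrite -subr_gt0 -/(W x).
  have [a ax aE] := WMVT _ _ (lexx _) x0 (ltW xs).
  have [b bx bE] := WMVT _ _ (ltW x0) xs (lexx _).
  have ba : dW b <= dW a by apply: dW_nincr; lra.
  rewrite ltNge; apply/negP => Wx.
  have sx : 0 < s - x by lra.
  have dWb : 0 <= dW b by rewrite -(pmulr_lge0 _ sx) -bE; lra.
  have : 0 <= dW a * (x - 0) by apply: mulr_ge0; lra.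
  lra.
have [a as_ aE] := WMVT _ _ (lexx _) s0 (lexx _).
have sa : dW s <= dW a by apply: dW_nincr; lra.
have dWs : dW s = - du s - du s.
  by rewrite /dW (_ : 2 * s - s = s)//; lra.
rewrite ltNge; apply/negP => dus.
have : 0 <= dW a * (s - 0) by apply: mulr_ge0; lra.
lra.
Qed.

(** * The moving plane *)

(** Minimizing x + y over the pairs x <= c <= y at which some function fails to
increase finds the first reflection point s = (x + y) / 2 at which domination
could break down, without moving s continuously. *)
Lemma moving_plane (R : realType) (u du h v dv k : R -> R) :
  concave_bump u du h -> concave_bump v dv k ->
  (forall x y : R, 0 < x < 1 -> 0 < y < 1 -> v x <= v y -> h x <= h y) ->
  (forall x y : R, 0 < x < 1 -> 0 < y < 1 -> u x <= u y -> k x <= k y) ->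
  [/\ forall a : R, 0 < a < 1 -> du a = 0 -> 1 / 2 <= a,
      forall a : R, 0 < a < 1 -> dv a = 0 -> 1 / 2 <= a &
      forall x : R, 0 <= x <= 1 / 2 -> u x <= u (1 - x) /\ v x <= v (1 - x)].
Proof.
move=> ub vb hv ku.
have [cu cu01 du0] := bump_critical ub.
have [cv cv01 dv0] := bump_critical vb.
pose c := Num.min (Num.min cu cv) (1 / 2).
have [ccu ccv c12] : [/\ c <= cu, c <= cv & c <= 1 / 2].
  by rewrite /c !ge_min !lexx !orbT.
have c0 : 0 < c by rewrite !lt_min; lra.
have cE : [\/ c = cu, c = cv | c = 1 / 2].
  rewrite /c /Num.min; case: ifP => _; last by constructor 3.
  by case: ifP => _; [constructor 1|constructor 2].
pose K := (`[0, c] `*` `[c, 1]) `&`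
  ([set z : R * R | 0 <= u z.1 - u z.2] `|` [set z | 0 <= v z.1 - v z.2]).
have closed_drop (f : R -> R) : continuous f ->
    closed [set z : R * R | 0 <= f z.1 - f z.2].
  move=> fc; apply: (@closed_comp _ _ (fun z : R * R => f z.1 - f z.2)
    [set t : R | 0 <= t]); last exact: closed_ge.
  move=> z _; apply: cvgB.
    by apply: continuous_comp; [exact: cvg_fst|exact: fc].
  by apply: continuous_comp; [exact: cvg_snd|exact: fc].
have Kcompact : compact K.
  apply: compact_closedI; first by apply: compact_setX; exact: segment_compact.
  by apply: closedU; apply: closed_drop;
    [exact: (bump_continuous ub)|exact: (bump_continuous vb)].
have Kcc : K (c, c).
  by split; [split; rewrite /= in_itv/=; lra|left; rewrite /= subrr].
have sum_continuous : continuous (fun z : R * R => z.1 + z.2).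
  by move=> z; apply: cvgD; [exact: cvg_fst|exact: cvg_snd].
have [] := compact_EVT_min (ex_intro _ _ Kcc) Kcompact
  (continuous_subspaceT sum_continuous).
move=> [x0 y0]; rewrite inE => -[[/=]]; rewrite !in_itv/= => x0c y0c x0y0 Kmin.
pose s := (x0 + y0) / 2.
have sc : s <= c.
  by have := Kmin (c, c); rewrite inE => /(_ Kcc)/=; rewrite /s; lra.
have s0 : 0 < s by rewrite /s; lra.
have below x y : 0 <= x -> x <= c -> c <= y -> x + y < 2 * s ->
    u x < u y /\ v x < v y.
  move=> xge xc cy xys.
  have notK : ~ K (x, y) by move=> /mem_set/Kmin/=; rewrite /s in xys; lra.
  split; rewrite ltNge; apply/negP => uv; apply: notK.
    by split; [split; rewrite /= in_itv/=; lra|left; rewrite /= subr_ge0].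
  by split; [split; rewrite /= in_itv/=; lra|right; rewrite /= subr_ge0].
(* A point x of [0, s] may reflect to the left of c, where both functions are
   nondecreasing, or to the right of c, where the pair (x, 2s - x) is a limit
   of pairs (x, y) whose midpoint is smaller than s. *)
have mono (f df g : R -> R) (cf : R) : concave_bump f df g ->
    0 < cf < 1 -> df cf = 0 -> c <= cf ->
    (forall x y : R, 0 <= x -> x <= c -> c <= y -> x + y < 2 * s -> f x < f y) ->
    forall x : R, 0 <= x <= s -> f x <= f (2 * s - x).
  move=> fb cf01 df0 ccf lt_f x xs.
  have [yc|cy] := leP (2 * s - x) c.
    by apply: (bump_nondecr fb cf01 df0); lra.
  rewrite leNgt; apply/negP => fyx.
  have : \forall y \near (2 * s - x)^'-, f y < f x.
    have fc : f y @[y --> (2 * s - x)^'-] --> f (2 * s - x).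
      by apply: cvg_at_left_filter; exact: (bump_continuous fb).
    exact: (cvgr_lt _ fc _ fyx).
  move=> near_lt.
  have : \forall y \near (2 * s - x)^'-, False.
    near=> y.
    have yx : f y < f x by near: y.
    have ylt : y < 2 * s - x by near: y; exact: nbhs_left_lt.
    have cly : c < y by near: y; exact: nbhs_left_gt.
    by have := @lt_f x y; lra.
  by move=> /filter_ex[].
have u_refl := mono _ _ _ _ ub cu01 du0 ccu
  (fun x y a b d e => (below x y a b d e).1).
have v_refl := mono _ _ _ _ vb cv01 dv0 ccv
  (fun x y a b d e => (below x y a b d e).2).
have [s12|s12] := ltP s (1 / 2).
  have [x xs|u_gap dus] := reflected_gap ub s0 s12.
    by apply: hv; [lra|lra|apply: v_refl; lra].
  have [x xs|v_gap dvs] := reflected_gap vb s0 s12.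
    by apply: ku; [lra|lra|apply: u_refl; lra].
  (* The minimal pair contradicts the strict gap unless x0 = y0 = s, and then
     s = c is a peak, which the positive derivatives exclude. *)
  have y0E : y0 = 2 * s - x0 by rewrite /s; lra.
  have [x0s|sx0] := ltP x0 s.
    have x0s' : 0 <= x0 < s by lra.
    have := u_gap _ x0s'; have := v_gap _ x0s'.
    by rewrite -y0E; case: x0y0 => /=; lra.
  have sE : s = c by rewrite /s in sx0 sc *; lra.
  by case: cE => E; move: dus dvs; rewrite sE E ?du0 ?dv0 ?ltxx//; lra.
have sE : s = 1 / 2 by lra.
split=> [a a01 da|a a01 da|x x12].
- by rewrite (bump_critical_uniq ub a01 cu01 da du0); lra.
- by rewrite (bump_critical_uniq vb a01 cv01 da dv0); lra.
have E : 1 - x = 2 * s - x by rewrite sE; lra.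
by rewrite E; split; [apply: u_refl|apply: v_refl]; lra.
Unshelve. all: by end_near. Qed.

Lemma bumps_symmetric (R : realType) (u du h v dv k : R -> R) :
  concave_bump u du h -> concave_bump v dv k ->
  (forall x y : R, 0 < x < 1 -> 0 < y < 1 -> v x <= v y -> h x <= h y) ->
  (forall x y : R, 0 < x < 1 -> 0 < y < 1 -> u x <= u y -> k x <= k y) ->
  [/\ forall x : R, 0 <= x <= 1 -> u (1 - x) = u x,
      forall x : R, 0 < x < 1 -> u x <= u (1 / 2) &
      forall x : R, 0 < x < 1 -> (du x = 0 <-> x = 1 / 2)].
Proof.
move=> ub vb hv ku.
have rev01 (x : R) : 0 < x < 1 -> 0 < 1 - x < 1 by lra.
have [cu_ge _ u_le] := moving_plane ub vb hv ku.
have [] := moving_plane (concave_bump_rev ub) (concave_bump_rev vb)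
  (fun x y x01 y01 => hv _ _ (rev01 x x01) (rev01 y y01))
  (fun x y x01 y01 => ku _ _ (rev01 x x01) (rev01 y y01)).
move=> cu_le _ u_ge.
have sym_half x : 0 <= x <= 1 / 2 -> u (1 - x) = u x.
  move=> x12; apply/eqP; rewrite eq_le (u_le _ x12).1 andbT.
  by have := (u_ge _ x12).1; rewrite subKr.
have sym x : 0 <= x <= 1 -> u (1 - x) = u x.
  move=> x01; have [x12|x12] := leP x (1 / 2); first by apply: sym_half; lra.
  by rewrite -[in RHS](subKr 1 x) (sym_half (1 - x))//; lra.
have crit x : 0 < x < 1 -> du x = 0 -> x = 1 / 2.
  move=> x01 dx; have := cu_ge _ x01 dx.
  by have := cu_le _ (rev01 _ x01); rewrite subKr dx oppr0 => /(_ erefl); lra.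
have d12 : du (1 / 2) = 0.
  by have [c c01 dc] := bump_critical ub; rewrite -(crit c c01 dc).
split=> // [x x01|x x01]; last by split=> [/crit->//|->].
have half01 : 0 < (1 / 2 : R) < 1 by lra.
have [x12|x12] := leP x (1 / 2).
  by apply: (bump_nondecr ub half01 d12); lra.
by rewrite -sym; [apply: (bump_nondecr ub half01 d12); lra|lra].
Qed.

(** * Classical solutions of the system *)

(** Compose with the projection of the line onto [0, 1]: as it takes its values
in [0, 1], continuity of f within this segment is enough. *)
Lemma extend_within01 (R : realType) (f : R -> R) :
  {within `[0, 1], continuous f} ->
  exists2 g : R -> R, continuous g & {in `[0, 1], g =1 f}.
Proof.
move=> /subspace_continuousP fc.
pose clamp (x : R) : R := Num.max 0 (Num.min 1 x).
have clamp01 x : `[0, 1]%classic (clamp x).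
  by rewrite /= in_itv/= le_max lexx/= ge_max ler01 ge_min lexx.
have clampc : continuous clamp.
  move=> x; apply: (@continuous_max _ _ (cst 0) (fun y : R => Num.min 1 y)).
    exact: cvg_cst.
  by apply: (@continuous_min _ _ (cst 1) id); [exact: cvg_cst|exact: cvg_id].
exists (f \o clamp) => [x|x].
  apply: (@cvg_comp _ _ _ clamp f _ (within `[0, 1] (nbhs (clamp x)))).
    move=> A; rewrite /= => /clampc /= near_A.
    have : \forall y \near x, `[0, 1]%classic (clamp y) -> A (clamp y).
      exact: near_A.
    by apply: filterS => y; apply; exact: clamp01.
  exact: fc.
by rewrite in_itv/= => /andP[x0 x1]; rewrite /= /clamp min_r// max_r.
Qed.

Lemma is_derive_eq_in01 (R : realType) (f g : R -> R) (x d : R) :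
  {in `[0, 1], g =1 f} -> 0 < x < 1 ->
  is_derive x 1 f d -> is_derive x 1 g d.
Proof.
move=> gf x01; apply: near_eq_is_derive.
have : \forall y \near x, y \in `]0, 1[.
  by apply: near_in_itvoo; rewrite in_itv.
by apply: filterS => y; rewrite in_itv/= => y01; rewrite gf// in_itv/=; lra.
Qed.

Lemma bump_of_solution (R : realType) (f g h : R -> R) :
  C2_on_oo 0 1 f -> continuous g -> {in `[0, 1], g =1 f} ->
  f 0 = 0 -> f 1 = 0 -> {in `]0, 1[, forall x, - f^`(2)%classic x = h x} ->
  {in `]0, 1[, forall x, 0 < f x} -> {in `]0, 1[, forall x, 0 < h x} ->
  concave_bump g f^`()%classic h.
Proof.
move=> [fd fdd _] gc gf f0 f1 fh fp hp.
have oo (x : R) : 0 < x < 1 -> x \in `]0, 1[ by rewrite in_itv.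
split=> // [||x x01|x x01|x /oo x01].
- by rewrite gf// in_itv/= lexx ler01.
- by rewrite gf// in_itv/= lexx ler01.
- by rewrite gf ?in_itv/=; [exact/fp/oo|lra].
- apply: (is_derive_eq_in01 gf x01); apply: DeriveDef; first exact/fd/oo.
  by rewrite derive1E.
- apply: DeriveDef; first exact: fdd.
  by rewrite -fh// opprK -derive1E.
Qed.

Lemma signed_pow_pos (R : realType) (s t : R) :
  0 < s -> 0 < t -> signed_pow s t = t `^ s.
Proof.
by move=> s0 t0; rewrite /signed_pow gtr0_norm// mulrC mulr_powRB1// ltW.
Qed.

(** The upper bound holds everywhere on (0, 1).  Conversely, near c the function
exceeds any given number below f c, and the interval where it does so has
positive length, so no smaller essential bound exists. *)
Lemma Linfty_norm01_max (R : realType) (f : R -> R) (c : R) :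
  0 < c < 1 -> {for c, continuous f} ->
  (forall x : R, 0 < x < 1 -> 0 <= f x <= f c) ->
  (f c)%:E = Linfty_norm01 f.
Proof.
move=> c01 fc fmax.
have muT : (0 < @lebesgue01 R setT)%E.
  rewrite /lebesgue01 /mrestr setTI lebesgue_measure_itv/= lte_fin ltr01.
  by rewrite oppr0 adde0 lte_fin.
rewrite /Linfty_norm01 unlock muT; apply/eqP; rewrite eq_le; apply/andP; split.
  rewrite leNgt; apply/negP => sup_lt.
  (* The essential supremum is an extended real; the case of minus infinity
     needs a finite number below f c as well. *)
  have [r supr rfc] : exists2 r : R,
      (ess_sup (@lebesgue01 R) (abse \o (EFin \o f)) <= r%:E)%E & r < f c.
    move: sup_lt; case: (ess_sup _ _) => [r||].
    - by rewrite lte_fin => rfc; exists r.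
    - by [].
    - by exists (f c - 1); rewrite ?leNye// ltrBlDr ltrDl ltr01.
  have [N [mN N0 subN]] := @ess_sup_ge _ _ _ (@lebesgue01 R) (abse \o (EFin \o f)).
  have near_gt : \forall y \near c, r < f y by exact: (cvgr_gt _ fc _ rfc).
  have near01 : \forall y \near c, y \in `]0, 1[.
    by apply: near_in_itvoo; rewrite in_itv.
  have [e /= e0 ballP] := filterI near_gt near01.
  pose I : set R := `]c - e, c + e[%classic.
  have ballN : I `<=` N `&` `]0, 1[.
    move=> y; rewrite /I/= in_itv/= => yce.
    have /ballP[ry y01] : `|c - y| < e by rewrite ltr_norml; lra.
    split=> //; apply: subN => /= fy.
    have := le_trans fy supr; rewrite lee_fin => /(le_trans (ler_norm _)).
    by rewrite leNgt ry.
  have : (0 < lebesgue_measure I)%E.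
    rewrite lebesgue_measure_itv/= lte_fin ifT; last by lra.
    by rewrite -EFinD lte_fin; lra.
  apply/negP; rewrite -leNgt -N0 /lebesgue01 /mrestr.
  apply: le_measure => //; rewrite inE; first exact: measurable_itv.
  by apply: measurableI => //; exact: measurable_itv.
apply/ess_supP.
exists (~` `]0, 1[); split.
- exact: measurableC.
- exact: etrans (congr1 lebesgue_measure (setICl _)) (measure0 _).
move=> x /= nx x01; apply: nx; rewrite lee_fin.
move: x01; rewrite in_itv/= => /fmax /andP[fx0 fxc].
by rewrite ger0_norm.
Qed.

Lemma signed_pow_gt0 (R : realType) (s t : R) :
  0 < t -> 0 < signed_pow s t.
Proof. by move=> t0; rewrite mulr_gt0// powR_gt0// normr_gt0 gt_eqF. Qed.

Lemma ler_signed_pow (R : realType) (s t t' : R) :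
  0 < s -> 0 < t -> t <= t' -> signed_pow s t <= signed_pow s t'.
Proof.
move=> s0 t0 tt'; have t'0 := lt_le_trans t0 tt'.
by rewrite !signed_pow_pos// ge0_ler_powR// ?nnegrE ltW.
Qed.

Unset Implicit Arguments.

Theorem proposition13 (R : realType) (p q r : R)
    (p_gt0 : 0 < p) (q_gt0 : 0 < q) (r_gt0 : 0 < r)
    (r_lt : r < 1 / q) (p_gt : Num.max 1 (1 / q) < p)
    (lambda : R) (lambda_gt0 : 0 < lambda) (u v : R -> R)
    (uv_sol : classical_solution lambda p q r u v)
    (uv_gt0 : {in `]0, 1[, forall x, 0 < u x /\ 0 < v x}) :
  [/\ (* (i) *)
      {in `[0, 1], forall x, u (1 - x) = u x /\ v (1 - x) = v x},
      (* (ii) *)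
      (u (1 / 2))%:E = Linfty_norm01 u /\ (v (1 / 2))%:E = Linfty_norm01 v &
      (* (iii) *)
      (forall x, critical_point01 u x <-> x = 1 / 2) /\
      (forall x, critical_point01 v x <-> x = 1 / 2)].
Proof.
case: uv_sol => -[[uC2 uc] [vC2 vc]] eq_u eq_v [u0 u1] [v0 v1].
have oo (x : R) : 0 < x < 1 -> x \in `]0, 1[ by rewrite in_itv.
have cc (x : R) : 0 < x < 1 -> x \in `[0, 1] by rewrite in_itv/=; lra.
have [gu guc guE] := extend_within01 uc.
have [gv gvc gvE] := extend_within01 vc.
pose h x := lambda * signed_pow r (v x) + signed_pow p (v x).
pose k x := signed_pow q (u x).
have ub : concave_bump gu u^`()%classic h.
  apply: (bump_of_solution uC2 guc guE u0 u1 eq_u) => x /uv_gt0[ux vx] //.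
  by apply: addr_gt0; [apply: mulr_gt0 => //|]; exact: signed_pow_gt0.
have vb : concave_bump gv v^`()%classic k.
  apply: (bump_of_solution vC2 gvc gvE v0 v1 eq_v) => x /uv_gt0[ux vx] //.
  exact: signed_pow_gt0.
have hv (x y : R) : 0 < x < 1 -> 0 < y < 1 -> gv x <= gv y -> h x <= h y.
  move=> x01 y01; rewrite !gvE ?cc// => vxy.
  have [_ vx] := uv_gt0 _ (oo _ x01).
  by rewrite lerD ?ler_pM2l// ler_signed_pow.
have ku (x y : R) : 0 < x < 1 -> 0 < y < 1 -> gu x <= gu y -> k x <= k y.
  move=> x01 y01; rewrite !guE ?cc// => uxy.
  have [ux _] := uv_gt0 _ (oo _ x01).
  exact: ler_signed_pow.
(* The extensions carry the symmetry; these are its consequences for the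
   solution, which agrees with them only on [0, 1]. *)
have back (f g : R -> R) : C2_on_oo 0 1 f -> {in `[0, 1], g =1 f} ->
    (forall x : R, 0 < x < 1 -> 0 < f x) ->
    [/\ forall x : R, 0 <= x <= 1 -> g (1 - x) = g x,
      forall x : R, 0 < x < 1 -> g x <= g (1 / 2) &
      forall x : R, 0 < x < 1 -> (f^`()%classic x = 0 <-> x = 1 / 2)] ->
    [/\ {in `[0, 1], forall x, f (1 - x) = f x},
      (f (1 / 2))%:E = Linfty_norm01 f &
      forall x, critical_point01 f x <-> x = 1 / 2].
  move=> [fd _ _] gf fp [sym max crit].
  have half01 : 0 < (1 / 2 : R) < 1 by lra.
  split=> [x x01||x].
  - have y01 : 1 - x \in `[0, 1] by move: x01; rewrite !in_itv/=; lra.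
    by rewrite -!gf// sym.
  - apply: (Linfty_norm01_max half01) => [|x x01].
      by apply/differentiable_continuous/derivable1_diffP/fd/oo.
    by rewrite ltW ?fp//= -!gf ?cc// max.
  split=> [[]|->].
    by rewrite in_itv/= => x01 fx0; apply/(crit _ x01); rewrite derive1E derive_val.
  split; first exact: oo.
  apply: DeriveDef; first exact/fd/oo.
  by rewrite -derive1E; apply/crit.
have up (x : R) : 0 < x < 1 -> 0 < u x by move=> /oo/uv_gt0[].
have vp (x : R) : 0 < x < 1 -> 0 < v x by move=> /oo/uv_gt0[].
have [u_sym u_max u_crit] := back _ _ uC2 guE up (bumps_symmetric ub vb hv ku).
have [v_sym v_max v_crit] := back _ _ vC2 gvE vp (bumps_symmetric vb ub ku hv).
by split=> [x x01||]; split; auto.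
Qed.
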